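(* Fix a field $K$. The class $\mathcal M_{QG}$ of matroids $M$ whose toric ideal $J_M$ has a Gr\''obner basis (with respect to some monomial order) consisting of quadratic binomials, and the class $\mathcal M_Q$ of matroids $M$ whose toric ideal $J_M$ is generated by quadratic binomials, are each closed under series extensions and parallel extensions: if $M$ belongs to the class, then so does every series extension and every parallel extension of $M$.
   Context: For a matroid $M$ on a finite ground set $E$ with bases $B_1,\dots,B_n$, the toric ideal $J_M$ is the kernel of the $K$-algebra homomorphism $K[x_1,\dots,x_n]\to K[s_e:e\in E]$, $x_j\mapsto\prod_{e\in B_j}s_e$. For a matroid $M$ on $[d]$ and $c\in[d]$, the series extension $M+_c(d+1)$ is the matroid on $[d+1]$ with bases $\{B\cup\{d+1\}: B\text{ a basis of }M\}\cup\{B\cup\{c\}: B\text{ a basis of }M,\ c\notin B\}$. The dual $M^*$ of $M$ is the matroid on $E$ whose bases are the complements $E\setminus B$ of bases $B$ of $M$. The parallel extension of $M$ at $c$ by $d+1$ is $(M^*+_c(d+1))^*$. *)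

(* Defs.v *)
From HB Require Import structures.
From mathcomp Require Import all_boot all_order all_algebra.
From mathcomp Require Import mpoly.

Set Implicit Arguments.
Unset Strict Implicit.
Unset Printing Implicit Defensive.

Import GRing.Theory.

Local Open Scope ring_scope.

Section BasisAxioms.
Variable E : finType.
Implicit Types Bs : {set {set E}}.

Definition basis_exchange Bs : bool :=
  [forall B1 in Bs, forall B2 in Bs, forall e in B1 :\: B2,
     exists f in B2 :\: B1, f |: (B1 :\ e) \in Bs].

Lemma basis_exchangeP Bs :
  reflect (forall B1 B2 e, B1 \in Bs -> B2 \in Bs -> e \in B1 -> e \notin B2 ->
             exists f, [/\ f \in B2, f \notin B1 & f |: (B1 :\ e) \in Bs])
          (basis_exchange Bs).
Proof.
apply: (iffP idP) => [ex B1 B2 e B1s B2s eB1 eB2 | ex].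
  move/forall_inP: ex => /(_ _ B1s)/forall_inP/(_ _ B2s)/forall_inP/(_ e).
  rewrite inE eB1 eB2 => /(_ isT)/exists_inP[f].
  by rewrite inE => /andP[fB1 fB2] h; exists f.
apply/forall_inP => B1 B1s; apply/forall_inP => B2 B2s; apply/forall_inP => e.
rewrite inE => /andP[eB2 eB1]; apply/exists_inP.
have [f [fB2 fB1 h]] := ex _ _ _ B1s B2s eB1 eB2.
by exists f => //; rewrite inE fB1.
Qed.

End BasisAxioms.

Record matroid (E : finType) := Matroid {
  bases : {set {set E}};
  bases_neq0 : bases != set0;
  bases_exchange : basis_exchange bases
}.

Section Dual.
Variables (E : finType) (M : matroid E).

Definition dual_bases : {set {set E}} := [set ~: B | B in bases M].

Lemma mem_dual_bases B : (B \in dual_bases) = (~: B \in bases M).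
Proof.
apply/imsetP/idP => [[C CM ->] | BM]; first by rewrite setCK.
by exists (~: B); rewrite ?setCK.
Qed.

Lemma dual_bases_neq0 : dual_bases != set0.
Proof.
have /set0Pn[B BM] := bases_neq0 M.
by apply/set0Pn; exists (~: B); apply: imset_f.
Qed.

Lemma basis_coexchange B1 B2 e :
  B1 \in bases M -> B2 \in bases M -> e \in B2 -> e \notin B1 ->
  exists f, [/\ f \in B1, f \notin B2 & e |: (B1 :\ f) \in bases M].
Proof.
have /basis_exchangeP ex := bases_exchange M.
move=> B1M; have [k] := ubnP #|B2 :\: B1|.
elim: k B2 => // k IHk B2 lek B2M eB2 eB1.
have [g | noG] := pickP [pred g | [&& g \in B2, g \notin B1 & g != e]].
  case/and3P=> gB2 gB1 gNe.
  have [h [hB1 hB2 B3M]] := ex _ _ _ B2M B1M gB2 gB1.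
  have eB3 : e \in h |: (B2 :\ g) by rewrite !inE eB2 (eq_sym e g) gNe orbT.
  have [|f [fB1 fB3 fM]] := IHk _ _ B3M eB3 eB1.
    suff D : (h |: (B2 :\ g)) :\: B1 = (B2 :\: B1) :\ g.
      by rewrite D; rewrite (cardsD1 g) !inE gB2 gB1 in lek.
    apply/setP=> x; rewrite !inE.
    by case: (eqVneq x h) => [->|_] /=; rewrite ?hB1 /= ?andbF // andbCA.
  exists f; split=> //; move: fB3; rewrite !inE negb_or negb_and negbK.
  by case/andP=> _ /orP[/eqP fg|//]; rewrite fg (negPf gB1) in fB1.
have [f [fB1 fB2 _]] := ex _ _ _ B2M B1M eB2 eB1.
have [g [gB2 gB1 gM]] := ex _ _ _ B1M B2M fB1 fB2.
exists f; split=> //; suff <- : g = e by [].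
by apply/eqP; move: (noG g); rewrite /= gB2 gB1 /= => /negbFE.
Qed.

Lemma dual_bases_exchange : basis_exchange dual_bases.
Proof.
apply/basis_exchangeP => B1 B2 e; rewrite !mem_dual_bases => B1M B2M eB1 eB2.
have [||f []] := basis_coexchange (e := e) B1M B2M; rewrite ?inE ?negbK //.
move=> fB1 fB2 fM; exists f; split=> //; rewrite mem_dual_bases.
suff -> : ~: (f |: (B1 :\ e)) = e |: ((~: B1) :\ f) by [].
apply/setP=> x; rewrite !inE negb_or negb_and negbK.
case: (eqVneq x e) => [->|_] //=.
by rewrite andbT; apply: contraNneq fB1 => <-.
Qed.

Definition dual : matroid E := Matroid dual_bases_neq0 dual_bases_exchange.

End Dual.

(* The ground set [d] is 'I_d; in 'I_d.+1 the new element d+1 is ord_max, and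
   the old ones are embedded by old. *)

Definition old (d : nat) : 'I_d -> 'I_d.+1 := widen_ord (leqnSn d).

Section Series.
Variables (d : nat) (M : matroid 'I_d) (c : 'I_d).

Definition series_bases : {set {set 'I_d.+1}} :=
  [set (@old d @: (B : {set 'I_d})) :|: [set ord_max] | B in bases M] :|:
  [set (@old d @: (B : {set 'I_d})) :|: [set old c] |
     B in bases M & c \notin B].

Lemma old_inj : injective (@old d).
Proof. by move=> i j /(congr1 val) /= /val_inj. Qed.

Lemma old_neq_max (i : 'I_d) : (old i == ord_max) = false.
Proof. by apply/negbTE; rewrite -val_eqE /= neq_ltn ltn_ord. Qed.

Lemma max_neq_old (i : 'I_d) : (ord_max == old i) = false.
Proof. by rewrite eq_sym old_neq_max. Qed.

Lemma mem_old (B : {set 'I_d}) i : (old i \in @old d @: B) = (i \in B).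
Proof. exact: mem_imset old_inj. Qed.

Lemma max_mem_old (B : {set 'I_d}) : (ord_max \in @old d @: B) = false.
Proof. by apply/imsetP => -[i _ /esym/eqP]; rewrite old_neq_max. Qed.

Lemma oldP (x : 'I_d.+1) : x = ord_max \/ exists i, x = old i.
Proof.
have [lt | ge] := ltnP x d; first by right; exists (Ordinal lt); apply: val_inj.
by left; apply: val_inj; apply/eqP; rewrite /= eqn_leq ge -ltnS ltn_ord.
Qed.

Lemma series_max B :
  B \in bases M -> (@old d @: B) :|: [set ord_max] \in series_bases.
Proof. by move=> BM; rewrite inE; apply/orP; left; apply: imset_f. Qed.

Lemma series_old B : B \in bases M -> c \notin B ->
  (@old d @: B) :|: [set old c] \in series_bases.
Proof.
move=> BM cB; rewrite inE; apply/orP; right.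
by apply/imsetP; exists B => //; rewrite inE BM.
Qed.

Lemma series_basesP X : X \in series_bases ->
  exists2 B, B \in bases M &
    X = (@old d @: B) :|: [set ord_max]
    \/ c \notin B /\ X = (@old d @: B) :|: [set old c].
Proof.
rewrite inE => /orP[/imsetP[B BM ->] | /imsetP[B]]; first by exists B; auto.
by rewrite inE => /andP[BM cB] ->; exists B; auto.
Qed.

Lemma series_bases_neq0 : series_bases != set0.
Proof.
have /set0Pn[B BM] := bases_neq0 M.
by apply/set0Pn; exists ((@old d @: B) :|: [set ord_max]); apply: series_max.
Qed.

Let inOld := (inE, mem_old, max_mem_old, old_neq_max, max_neq_old,
              inj_eq old_inj, eqxx, orbF, orbT).

Lemma series_bases_exchange : basis_exchange series_bases.
Proof.
have /basis_exchangeP ex := bases_exchange M.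
apply/basis_exchangeP => X1 X2 e.
case/series_basesP=> B1 B1M d1 /series_basesP[B2 B2M d2].
have setE (X Y : {set 'I_d.+1}) : X \in series_bases ->
    (forall i, (old i \in Y) = (old i \in X)) ->
    (ord_max \in Y) = (ord_max \in X) -> Y \in series_bases.
  move=> XS hold hmax; suff -> : Y = X by [].
  by apply/setP=> x; case: (oldP x) => [|[i]] ->.
have [-> | [i ->]] := oldP e.
  case: d1 d2 => [|[cB1]] -> [|[cB2]] ->; rewrite !inOld //= => _ _.
  have [cB1 | cB1] := boolP (c \in B1); last first.
    exists (old c); split; [by rewrite !inOld ?(negPf cB1)..|].
    apply: (setE _ _ (series_old B1M cB1)) => [j|]; rewrite !inOld //=.
    by rewrite orbC.
  have [f [fB2 fB1 fM]] := ex _ _ _ B1M B2M cB1 cB2.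
  have cf : c != f by apply: contraNneq fB1 => <-.
  exists (old f); split; [by rewrite !inOld /= ?fB2 ?(negPf fB1)..|].
  apply: (setE _ _ (series_old fM _)) => [|j|]; rewrite !inOld ?eqxx ?orbF //=.
  by case: (eqVneq j c) => [->|]; rewrite ?cB1 ?orbT ?orbF.
case: d1 d2 => [|[cB1]] -> [|[cB2]] ->; rewrite !inOld /= ?orbF.
- move=> iB1 iB2; have [f [fB2 fB1 fM]] := ex _ _ _ B1M B2M iB1 iB2.
  exists (old f); split; [by rewrite !inOld /= ?fB2 ?(negPf fB1)..|].
  by apply: (setE _ _ (series_max fM)) => [j|]; rewrite !inOld /= ?orbF.
- move=> iB1; rewrite negb_or => /andP[iB2 _].
  have [f [fB2 fB1 fM]] := ex _ _ _ B1M B2M iB1 iB2.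
  exists (old f); split; [by rewrite !inOld /= ?fB2 ?(negPf fB1)..|].
  by apply: (setE _ _ (series_max fM)) => [j|]; rewrite !inOld /= ?orbF.
- have [-> _ cB2 | ic] := eqVneq i c.
    exists ord_max; split; [by rewrite !inOld..|].
    apply: (setE _ _ (series_max B1M)) => [j|]; rewrite !inOld /= ?orbF //.
    by case: (eqVneq j c) => [->|]; rewrite ?(negPf cB1) ?orbF.
  rewrite orbF => iB1 iB2; have [f [fB2 fB1 fM]] := ex _ _ _ B1M B2M iB1 iB2.
  have [fc | fc] := eqVneq f c.
    rewrite fc in fM; exists ord_max; split; [by rewrite !inOld..|].
    apply: (setE _ _ (series_max fM)) => [j|]; rewrite !inOld /= ?orbF //.
    by case: (eqVneq j c) => [->|]; rewrite !inOld //= (eq_sym c i) ic.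
  exists (old f); split;
    [by rewrite !inOld /= ?fB2 ?(negPf fB1) ?(negPf fc)..|].
  apply: (setE _ _ (series_old fM _)) => [|j|]; rewrite !inOld /= ?orbF //.
    by rewrite (eq_sym c f) (negPf fc) (negPf cB1) andbF.
  by case: (eqVneq j c) => [->|]; rewrite !inOld //= (eq_sym c i) ic orbT.
have [-> _ | ic] := eqVneq i c; first by rewrite orbT.
rewrite !orbF => iB1 iB2; have [f [fB2 fB1 fM]] := ex _ _ _ B1M B2M iB1 iB2.
have fc : c != f by apply: contraNneq cB2 => ->.
exists (old f); split;
  [by rewrite !inOld /= ?fB2 ?(negPf fB1) ?(eq_sym f c) ?(negPf fc)..|].
apply: (setE _ _ (series_old fM _)) => [|j|]; rewrite !inOld //=.
  by rewrite (negPf fc) (negPf cB1) andbF.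
by case: (eqVneq j c) => [->|]; rewrite !inOld //= (eq_sym c i) ic orbT.
Qed.

Definition series_ext : matroid 'I_d.+1 :=
  Matroid series_bases_neq0 series_bases_exchange.

End Series.

Definition parallel_ext (d : nat) (M : matroid 'I_d) (c : 'I_d) :
    matroid 'I_d.+1 :=
  dual (series_ext (dual M) c).

Definition ideal_gen (R : comNzRingType) (S : R -> Prop) (p : R) : Prop :=
  exists2 s : seq (R * R),
    forall ag, ag \in s -> S ag.2 & p = \sum_(ag <- s) ag.1 * ag.2.

Definition monomial_order (n : nat) (le : rel 'X_{1..n}) : Prop :=
  [/\ antisymmetric le, transitive le, total le, forall m, le 0%MM m &
      forall m1 m2 m, le m1 m2 -> le (m1 + m)%MM (m2 + m)%MM].

Section Groebner.
Variables (K : fieldType) (n : nat).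
Implicit Types (le : rel 'X_{1..n}) (I : {pred {mpoly K[n]}})
               (G : seq {mpoly K[n]}).

(* [mlead] is tied to the degrevlex order; here the order is arbitrary.
   The zero polynomial has no leading monomial. *)
Definition leading_monomial le (p : {mpoly K[n]}) (m : 'X_{1..n}) : Prop :=
  m \in msupp p /\ forall m', m' \in msupp p -> le m' m.

Definition initial_monomials le I (q : {mpoly K[n]}) : Prop :=
  exists p m, [/\ p \in I, leading_monomial le p m & q = 'X_[m]].

Definition groebner_basis le I G : Prop :=
  {subset G <= I} /\
  forall q, ideal_gen (initial_monomials le I) q <->
            ideal_gen (initial_monomials le (mem G)) q.

Definition generates G I : Prop :=
  forall p, p \in I <-> ideal_gen (fun g => g \in G) p.

Definition is_binomial (p : {mpoly K[n]}) : Prop :=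
  exists u v : 'X_{1..n}, u != v /\ p = 'X_[u] - 'X_[v].

(* [msize] is one more than the total degree. *)
Definition is_quadratic (p : {mpoly K[n]}) : Prop := msize p = 3%N.

Definition quadratic_binomials G : Prop :=
  forall g, g \in G -> is_binomial g /\ is_quadratic g.

End Groebner.

Section Toric.
Variables (K : fieldType) (E : finType) (M : matroid E).

Definition nbases : nat := #|bases M|.

Definition basis (j : 'I_nbases) : {set E} := enum_val j.

(* The variable s_e is 'X_(enum_rank e). *)
Definition toric_map (p : {mpoly K[nbases]}) : {mpoly K[#|E|]} :=
  p \mPo [tuple \prod_(e in basis j) 'X_(enum_rank e) | j < nbases].

Definition toric_ideal : {pred {mpoly K[nbases]}} :=
  [pred p | toric_map p == 0].

Definition class_QG : Prop :=
  exists (le : rel 'X_{1..nbases}) (G : seq {mpoly K[nbases]}),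
    [/\ monomial_order le, groebner_basis le toric_ideal G &
        quadratic_binomials G].

Definition class_Q : Prop :=
  exists2 G : seq {mpoly K[nbases]},
    generates G toric_ideal & quadratic_binomials G.

End Toric.

(* Main.v *)
(** Once the degree is fixed, the toric ideal of a matroid is spanned by the
differences of monomials lying in a common fiber of the exponent map.
Quadratic generation then means that the fibers are connected under quadratic
moves, and having a quadratic Groebner basis means that, for some monomial
order, a monomial that cannot be decreased by a quadratic move is the least
element of its fiber.

A basis of the series extension is a basis B of M together with a bit t
(whether d+1 was added), the value t = 0 being allowed only if B does not
contain c.  The sum of the bits is constant on fibers, and so is the number of
bases avoiding c; hence quadratic moves of M lift, and two monomials over the
same monomial of M are related by quadratic moves that exchange the bits of two
bases.  For Groebner bases, compare first the underlying monomials of M, and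
break ties by any monomial order.

At fixed degree the fibers of a matroid and of its dual agree, which settles
parallel extensions.  Rank zero is special: the toric ideal is not homogeneous
there.  It has no quadratic Groebner basis, but it is generated by all
x^2 - x and x^2 - 1. *)

From mathcomp Require Import all_boot all_order all_algebra.
From mathcomp Require Import mpoly zify ring.
From Stdlib Require Import Classical ClassicalEpsilon.
(* [Defs] comes last so that [basis] is not shadowed by the one of mpoly. *)
Require Import Defs.

Set Implicit Arguments.
Unset Strict Implicit.
Unset Printing Implicit Defensive.

Import GRing.Theory.

(** * Fibers and quadratic moves *)

Section Weights.
Variable n : nat.
Implicit Types (u v a b m : 'X_{1..n}) (w : 'I_n -> nat).

Lemma mnm_ind (P : 'X_{1..n} -> Prop) :
  P 0%MM -> (forall i m, P m -> P (U_(i) + m)%MM) -> forall m, P m.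
Proof.
move=> P0 PS m; have [k] := ubnP (mdeg m); elim: k m => // k IH m ltmk.
have [i mi | m0] := pickP (fun i => m i != 0); last first.
  suff -> : m = 0%MM by [].
  by apply/mnmP=> i; rewrite mnm0E; apply/eqP/negbFE/m0.
have le1m : (U_(i) <= m)%MM by rewrite lep1mP.
rewrite -(submK le1m) addmC; apply/PS/IH.
by move: ltmk; rewrite -{1}(submK le1m) mdegD mdeg1 addn1 ltnS.
Qed.

Definition wt w u : nat := \sum_(i < n) u i * w i.

Lemma wtD w u v : wt w (u + v)%MM = wt w u + wt w v.
Proof.
by rewrite /wt -big_split; apply: eq_bigr => i _; rewrite mnmDE mulnDl.
Qed.

Lemma wtU w i : wt w U_(i)%MM = w i.
Proof.
rewrite /wt (bigD1 i) //= mnm1E eqxx mul1n big1 ?addn0 // => j ji.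
by rewrite mnm1E eq_sym (negPf ji).
Qed.

Lemma wt0 w : wt w 0%MM = 0.
Proof. by rewrite /wt big1 // => i _; rewrite mnm0E. Qed.

Lemma eq_wt w w' u : w =1 w' -> wt w u = wt w' u.
Proof. by move=> eqw; apply: eq_bigr => i _; rewrite eqw. Qed.

Lemma leq_wt w w' u : (forall i, w i <= w' i) -> wt w u <= wt w' u.
Proof. by move=> lew; apply: leq_sum => i _; rewrite leq_mul2l lew orbT. Qed.

Lemma wt_add w w' u : wt (fun i => w i + w' i) u = wt w u + wt w' u.
Proof. by rewrite /wt -big_split; apply: eq_bigr => i _; rewrite mulnDr. Qed.

Lemma wt_const k u : wt (fun=> k) u = mdeg u * k.
Proof. by rewrite /wt -big_distrl /= -mdegE. Qed.

Lemma wt_compl (t : 'I_n -> bool) u :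
  wt (fun i => ~~ t i : nat) u + wt (fun i => t i : nat) u = mdeg u.
Proof.
rewrite -wt_add -[RHS]muln1 -wt_const; apply: eq_wt => i.
by case: (t i).
Qed.

Lemma wt_exchange (t : pred 'I_n) u v :
  wt (fun i => t i : nat) u = wt (fun i => t i : nat) v ->
  forall i, t i -> v i < u i -> exists2 j, t j & u j < v j.
Proof.
move=> eqw i ti lti.
have [/exists_inP //|noj] := boolP [exists (j | t j), u j < v j].
suff : wt (fun i => t i : nat) v < wt (fun i => t i : nat) u.
  by rewrite eqw ltnn.
rewrite /wt (bigD1 i) //= [ltnRHS](bigD1 i) //= ti !muln1 -addSn.
apply: leq_add => //; apply: leq_sum => j _; rewrite leq_mul2r; apply/orP.
case: (boolP (t j)) => tj; [right | by left]; rewrite leqNgt.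
by apply: contra noj => lt; apply/exists_inP; exists j.
Qed.

Variables (E : finType) (W : E -> 'I_n -> nat).

Definition fiber u v : Prop :=
  mdeg u = mdeg v /\ forall e, wt (W e) u = wt (W e) v.

Lemma fiber_refl u : fiber u u. Proof. by []. Qed.

Lemma fiber_sym u v : fiber u v -> fiber v u.
Proof. by case=> dE wE; split=> // e; rewrite wE. Qed.

Lemma fiber_trans u v m : fiber u v -> fiber v m -> fiber u m.
Proof. by case=> d1 w1 [d2 w2]; split=> [|e]; rewrite ?d1 ?w1. Qed.

Lemma fiber_addl m u v : fiber (m + u)%MM (m + v)%MM <-> fiber u v.
Proof.
by split=> -[dE wE]; split=> [|e]; move: dE (wE); rewrite ?mdegD;
   [move/addnI | move=> _ /(_ e); rewrite !wtD => /addnI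
   |move=> -> | move=> _ {}wE; rewrite !wtD wE].
Qed.

Inductive qconn : 'X_{1..n} -> 'X_{1..n} -> Prop :=
| qconn_refl u : qconn u u
| qconn_step m a b v :
    mdeg a = 2 -> fiber a b -> qconn (m + b)%MM v -> qconn (m + a)%MM v.

Lemma qconn_trans u v m : qconn u v -> qconn v m -> qconn u m.
Proof. by elim=> // w a b y da fab _ IH /IH; apply: qconn_step. Qed.

Definition quadratically_connected : Prop := forall u v, fiber u v -> qconn u v.

Definition locally_minimal (le : rel 'X_{1..n}) u : Prop :=
  forall a b, (a <= u)%MM -> mdeg a = 2 -> fiber a b -> le a b.

Definition quadratically_minimized : Prop :=
  exists2 le, monomial_order le &
    forall u v, locally_minimal le u -> fiber u v -> le u v.

End Weights.

Lemma mnmc_monomial_order n :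
  monomial_order (fun u v : 'X_{1..n} => (u <= v)%O).
Proof.
split; [exact: Order.POrderTheory.le_anti | exact: Order.POrderTheory.le_trans
 |exact: Order.TotalTheory.le_total | exact: le0m |].
by move=> m1 m2 m; rewrite lemc_add2l.
Qed.

Section Push.
Variables (n m : nat) (pi : 'I_m -> 'I_n).
Implicit Types (u v a b : 'X_{1..m}) (x y : 'X_{1..n}).

Definition push u : 'X_{1..n} :=
  [multinom \sum_(j < m | pi j == i) u j | i < n].

Lemma pushE u i : push u i = wt (fun j => pi j == i : nat) u.
Proof.
rewrite mnmE /wt big_mkcond; apply: eq_bigr => j _.
by case: eqP; rewrite ?muln1 ?muln0.
Qed.

Lemma pushD u v : push (u + v)%MM = (push u + push v)%MM.
Proof. by apply/mnmP=> i; rewrite mnmDE !pushE wtD. Qed.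

Lemma push0 : push 0%MM = 0%MM.
Proof. by apply/mnmP=> i; rewrite mnm0E pushE wt0. Qed.

Lemma pushU j : push U_(j)%MM = U_(pi j)%MM.
Proof. by apply/mnmP=> i; rewrite mnm1E pushE wtU. Qed.

Lemma wt_push w u : wt w (push u) = wt (w \o pi) u.
Proof.
elim/mnm_ind: u => [|j u IH]; first by rewrite push0 !wt0.
by rewrite pushD !wtD pushU !wtU IH.
Qed.

Lemma mdeg_push u : mdeg (push u) = mdeg u.
Proof. by rewrite -[LHS]muln1 -[RHS]muln1 -!wt_const wt_push. Qed.

Lemma push_split x u : (x <= push u)%MM ->
  exists2 a, (a <= u)%MM & push a = x.
Proof.
elim/mnm_ind: x u => [|i x IH] u.
  by exists 0%MM; rewrite ?push0 //; apply/mnm_lepP=> j; rewrite mnm0E.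
move/mnm_lepP=> le.
have /existsP[j /andP[/eqP pij uj]] : [exists j, (pi j == i) && (u j != 0)].
  apply: contraT => /existsPn noj; move: (le i).
  rewrite mnmDE mnm1E eqxx mnmE big1 // => j pij.
  by move: (noj j); rewrite pij negbK => /eqP.
have leju : (U_(j) <= u)%MM by rewrite lep1mP.
have eu := submK leju.
have [|a lea pa] := IH (u - U_(j))%MM.
  apply/mnm_lepP=> k; move: (le k).
  by rewrite -{1}eu pushD pushU pij !mnmDE [leqRHS]addnC leq_add2l.
exists (U_(j) + a)%MM; last by rewrite pushD pushU pij pa.
apply/mnm_lepP=> k; rewrite -eu !mnmDE [leqRHS]addnC leq_add2l.
exact: (mnm_lepP lea).
Qed.

End Push.

Section Extension.
Variables (n m : nat) (E F : finType).
Variables (W : E -> 'I_n -> nat) (V : F -> 'I_m -> nat).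
Variables (pi : 'I_m -> 'I_n) (t : pred 'I_m) (free : pred 'I_n).
Hypothesis lift_index : forall i b,
  b || free i -> exists2 j, pi j = i & t j = b.
Hypothesis index_free : forall j, t j || free (pi j).
Hypothesis index_inj : forall j j', pi j = pi j' -> t j = t j' -> j = j'.
Local Notation tcount := (wt (fun j => t j : nat)).
Hypothesis fiberV : forall u v,
  fiber V u v <-> fiber W (push pi u) (push pi v) /\ tcount u = tcount v.
Hypothesis fiber_free : forall x y, fiber W x y ->
  wt (fun i => free i : nat) x = wt (fun i => free i : nat) y.
Implicit Types (u v a b : 'X_{1..m}) (x y : 'X_{1..n}).

Lemma lift_mnm y k : k <= wt (fun i => free i : nat) y ->
  exists2 b, push pi b = y & tcount b + k = mdeg y.
Proof.
elim/mnm_ind: y k => [|i y IH] k.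
  rewrite wt0 leqn0 => /eqP->; exists 0%MM; first exact: push0.
  by rewrite wt0 mdeg0.
rewrite wtD wtU mdegD mdeg1; have [fi|nfi] := boolP (free i); case: k => [|k].
- move=> _; have [b pb tb] := IH 0 (leq0n _).
  have [j pj tj] := @lift_index i true isT.
  exists (U_(j) + b)%MM; first by rewrite pushD pushU pj pb.
  by rewrite wtD wtU tj -tb; lia.
- rewrite add1n ltnS => /IH[b pb tb].
  have [j pj tj] := @lift_index i false fi.
  exists (U_(j) + b)%MM; first by rewrite pushD pushU pj pb.
  by rewrite wtD wtU tj -tb; lia.
- move=> _; have [b pb tb] := IH 0 (leq0n _).
  have [j pj tj] := @lift_index i true isT.
  exists (U_(j) + b)%MM; first by rewrite pushD pushU pj pb.
  by rewrite wtD wtU tj -tb; lia.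
rewrite add0n => /IH[b pb tb].
have [j pj tj] := @lift_index i true isT.
exists (U_(j) + b)%MM; first by rewrite pushD pushU pj pb.
by rewrite wtD wtU tj -tb; lia.
Qed.

Lemma lift_fiber a y : fiber W (push pi a) y ->
  exists2 b, push pi b = y & fiber V a b.
Proof.
move=> fay; have [|b pb tb] := @lift_mnm y (wt (fun j => ~~ t j : nat) a).
  rewrite -(fiber_free fay) wt_push; apply: leq_wt => j /=.
  by move: (index_free j); case: (t j) => //= ->.
exists b => //; apply/fiberV; rewrite pb; split=> //.
apply: (@addIn (wt (fun j => ~~ t j : nat) a)).
by rewrite tb -(proj1 fay) mdeg_push addnC wt_compl.
Qed.

(* Some j0 occurs more often in u than in v.  As the pushes agree, j0 has a twin
   j1 over the same index, with the other bit, occurring more often in v; as the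
   bit counts agree, some j2 with the bit of j0 also occurs more often in v, and
   its twin j3 more often in u.  Trade j0 + j3 for j1 + j2. *)
Lemma swap_step u v : push pi u = push pi v -> tcount u = tcount v -> u <> v ->
  exists a b, [/\ (a <= u)%MM, (b <= v)%MM, mdeg a = 2,
    push pi a = push pi b & fiber V a b] /\
    (mdeg (u - (v - b + a))%MM < mdeg (u - v)%MM)%N.
Proof.
move=> epi etc neq.
have eqi i : wt (fun j => pi j == i : nat) u = wt (fun j => pi j == i : nat) v.
  by rewrite -!pushE epi.
have edeg : mdeg u = mdeg v by rewrite -(mdeg_push pi) epi mdeg_push.
have etb (b : bool) :
    wt (fun j => t j == b : nat) u = wt (fun j => t j == b : nat) v.
  have tt (x : 'X_{1..m}) : wt (fun j => t j == true : nat) x = tcount x.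
    by apply: eq_wt => j; case: (t j).
  have tf (x : 'X_{1..m}) :
      wt (fun j => t j == false : nat) x = wt (fun j => ~~ t j : nat) x.
    by apply: eq_wt => j; case: (t j).
  case: b; rewrite ?tt ?tf //; apply: (@addIn (tcount u)).
  by rewrite {2}etc !wt_compl.
have /existsP[j0 lt0] : [exists j, v j < u j].
  apply: contraT => /existsPn le; case: neq; apply/mnmP=> j.
  apply/eqP; rewrite eqn_leq leqNgt le /= leqNgt; apply/negP=> lt.
  have edeg1 : wt (fun=> 1) v = wt (fun=> 1) u by rewrite !wt_const edeg.
  have [j' _] := @wt_exchange _ predT v u edeg1 j isT lt.
  by rewrite (negPf (le j')).
have [j1 /eqP p1 lt1] := wt_exchange (eqi (pi j0)) (eqxx _) lt0.
have [j2 /eqP t2 lt2] := wt_exchange (etb (t j0)) (eqxx _) lt0.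
have [j3 /eqP p3 lt3] := wt_exchange (esym (eqi (pi j2))) (eqxx _) lt2.
have t1 : t j1 = ~~ t j0.
  have : t j1 != t j0; last by case: (t j1); case: (t j0).
  by apply/eqP=> t1; move: lt1; rewrite (index_inj p1 t1) ltnNge ltnW.
have t3 : t j3 = ~~ t j2.
  have : t j3 != t j2; last by case: (t j3); case: (t j2).
  by apply/eqP=> t3; move: lt3; rewrite (index_inj p3 t3) ltnNge ltnW.
have n03 : j0 <> j3.
  by move=> e; move: t3; rewrite -e t2; case: (t j0).
have n12 : j1 <> j2.
  by move=> e; move: t1; rewrite e t2; case: (t j0).
have pE : push pi (U_(j0) + U_(j3))%MM = push pi (U_(j1) + U_(j2))%MM.
  by rewrite !pushD !pushU p1 p3.
exists (U_(j0) + U_(j3))%MM, (U_(j1) + U_(j2))%MM; split; first split=> //.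
- apply/mnm_lepP=> k; rewrite mnmDE !mnm1E.
  by case: (eqVneq j0 k) => [<-|_]; case: (eqVneq j3 _) => [e|_] //=;
    [case: n03 | lia | rewrite -e; lia].
- apply/mnm_lepP=> k; rewrite mnmDE !mnm1E.
  by case: (eqVneq j1 k) => [<-|_]; case: (eqVneq j2 _) => [e|_] //=;
    [case: n12 | lia | rewrite -e; lia].
- by rewrite mdegD !mdeg1.
- apply/fiberV; split; first by rewrite pE.
  by rewrite !wtD !wtU t1 t3 t2; case: (t j0).
rewrite !mdegE (bigD1 j0) //= [ltnRHS](bigD1 j0) //= -addSn.
apply: leq_add.
  rewrite !mnmE eqxx.
  have [e|_] := eqVneq j1 j0; first by rewrite e in lt1; lia.
  by have [e|_] := eqVneq j2 j0; [rewrite e in lt2; lia | lia].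
apply: leq_sum => k _; rewrite !mnmE.
have [<-|_] := eqVneq j1 k; have [e|_] := eqVneq j2 _; try by lia.
  by case: n12.
by rewrite -e; lia.
Qed.

Lemma push_fiber_step u v a b : push pi u = push pi v -> tcount u = tcount v ->
  (b <= v)%MM -> push pi a = push pi b -> fiber V a b ->
  push pi u = push pi (v - b + a)%MM /\ tcount u = tcount (v - b + a)%MM.
Proof.
move=> epi etc leb pE /fiberV[_ tE]; rewrite epi etc.
by rewrite -{1 3}(submK leb) !pushD !wtD pE tE.
Qed.

Lemma push_qconn u v : push pi u = push pi v -> tcount u = tcount v ->
  qconn V u v.
Proof.
have [k] := ubnP (mdeg (v - u)%MM).
elim: k u v => // k IH u v ltk epi etc.
have [-> | /eqP neq] := eqVneq v u; first exact: qconn_refl.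
have [a [b [[lea leb da pE fE] dist]]] := swap_step (esym epi) (esym etc) neq.
have [pi' tc'] := push_fiber_step (esym epi) (esym etc) leb pE fE.
rewrite -(submK leb); apply: qconn_step (fiber_sym fE) _.
  by rewrite -(proj1 fE).
by apply: IH => //; apply: leq_trans dist _.
Qed.

Lemma lift_qconn x y : qconn W x y -> forall u, push pi u = x ->
  exists2 v, push pi v = y & qconn V u v /\ fiber V u v.
Proof.
elim=> [z u pu | z a b y' da fab _ IH u pu].
  by exists u => //; split; [exact: qconn_refl | exact: fiber_refl].
have [|a' lea pa] := @push_split _ _ pi a u; first by rewrite pu lem_addl.
have [|b' pb fab'] := @lift_fiber a' b; first by rewrite pa.
have [|v pv [qv fv]] := IH (u - a' + b')%MM.
  by rewrite pushD pb; congr mnm_add; apply: (@addIm _ a);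
     rewrite -{1}pa -pushD submK.
exists v => //; rewrite -(submK lea); split.
  by apply: qconn_step qv => //; rewrite -(mdeg_push pi) pa.
by apply: fiber_trans fv; apply/fiber_addl.
Qed.

Lemma quadratically_connected_ext :
  quadratically_connected W -> quadratically_connected V.
Proof.
move=> QW u v fuv; have /fiberV[fp _] := fuv.
have [u' pu [qu fu]] := lift_qconn (QW _ _ fp) erefl.
have /fiberV[_ tc] := fiber_trans (fiber_sym fu) fuv.
by apply: qconn_trans qu _; apply: push_qconn.
Qed.

Lemma quadratically_minimized_ext :
  quadratically_minimized W -> quadratically_minimized V.
Proof.
case=> le [le_anti le_trans le_total le_min le_add] minW.
have [co_anti co_trans co_total co_min co_add] := mnmc_monomial_order m.
pose le' u v :=
  if push pi u == push pi v then (u <= v)%O else le (push pi u) (push pi v).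
have lexx x : le x x by case/orP: (le_total x x).
have le'W u v : le' u v -> le (push pi u) (push pi v).
  by rewrite /le'; case: eqP => // ->.
exists le' => [|u v umin fuv].
  split.
  - move=> u v /andP[luv lvu].
    have epi : push pi u = push pi v by apply: le_anti; rewrite !le'W.
    move: luv lvu; rewrite /le' epi eqxx => luv lvu.
    by apply: co_anti; rewrite luv.
  - move=> v u w luv lvw; rewrite /le'; case: eqP => [euw|_]; last first.
      exact: le_trans (le'W _ _ luv) (le'W _ _ lvw).
    have epi : push pi u = push pi v.
      by apply: le_anti; rewrite le'W //= euw le'W.
    move: luv lvw; rewrite /le' -epi -euw !eqxx; exact: co_trans.
  - move=> u v; rewrite /le' (eq_sym (push pi v)).
    by case: eqP => _; [apply: co_total | apply: le_total].
  - move=> u; rewrite /le'; case: eqP => _; first exact: co_min.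
    by rewrite push0; apply: le_min.
  move=> u v w; rewrite /le' !pushD eqm_add2r.
  by case: eqP => _; [apply: co_add | apply: le_add].
have /fiberV[fp tc] := fuv.
have lep : le (push pi u) (push pi v).
  apply: minW fp => a b lea da fab.
  have [a' lea' pa] := push_split lea.
  have [|b' pb fab'] := @lift_fiber a' b; first by rewrite pa.
  by rewrite -pa -pb; apply: le'W; apply: umin => //;
    rewrite -(mdeg_push pi) pa.
rewrite /le'; case: eqP => // epi {lep fp fuv}.
have [k] := ubnP (mdeg (u - v)%MM); elim: k v epi tc => // k IH v epi tc ltk.
have [-> | /eqP neq] := eqVneq u v; first exact: Order.POrderTheory.lexx.
have [a [b [[lea leb da pE fE] dist]]] := swap_step epi tc neq.
have [pi' tc'] := push_fiber_step epi tc leb pE fE.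
have leab : (a <= b)%O by have := umin _ _ lea da fE; rewrite /le' pE eqxx.
apply: co_trans (IH _ pi' tc' (leq_trans dist ltk)) _.
by rewrite -[X in (_ <= X)%O](submK leb) lemc_add2r.
Qed.

Lemma quadratic_ext :
  (quadratically_connected W -> quadratically_connected V) /\
  (quadratically_minimized W -> quadratically_minimized V).
Proof.
split; first exact: quadratically_connected_ext.
exact: quadratically_minimized_ext.
Qed.

End Extension.

(** * Toric ideals and their fibers *)

Section IdealGen.
Local Open Scope ring_scope.
Variable R : comNzRingType.
Implicit Types (S T : R -> Prop) (p q a : R).

Lemma ideal_gen0 S : ideal_gen S 0.
Proof. by exists [::]; rewrite ?big_nil. Qed.

Lemma ideal_gen_mem S p : S p -> ideal_gen S p.
Proof.
move=> Sp; exists [:: (1, p)]; last by rewrite big_seq1 mul1r.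
by move=> ag; rewrite inE => /eqP->.
Qed.

Lemma ideal_genD S p q : ideal_gen S p -> ideal_gen S q -> ideal_gen S (p + q).
Proof.
case=> s1 S1 -> [s2 S2 ->]; exists (s1 ++ s2); last by rewrite big_cat.
by move=> ag; rewrite mem_cat => /orP[/S1 | /S2].
Qed.

Lemma ideal_genM S a p : ideal_gen S p -> ideal_gen S (a * p).
Proof.
case=> s Ss ->; exists [seq (a * x.1, x.2) | x <- s].
  by move=> ag /mapP[x xs ->] /=; apply: (Ss x).
by rewrite big_map mulr_sumr; apply: eq_bigr => x _; rewrite mulrA.
Qed.

Lemma ideal_gen_sub S T p :
  (forall g, S g -> ideal_gen T g) -> ideal_gen S p -> ideal_gen T p.
Proof.
move=> ST [s Ss ->]; elim: s Ss => [|x s IH] Ss.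
  by rewrite big_nil; apply: ideal_gen0.
rewrite big_cons; apply: ideal_genD.
  by apply: ideal_genM; apply: ST; apply: Ss; exact: mem_head.
by apply: IH => y ys; apply: Ss; rewrite inE ys orbT.
Qed.

End IdealGen.

Section MonomialIdeals.
Local Open Scope ring_scope.
Variables (K : fieldType) (n : nat).
Implicit Types (u v a b m : 'X_{1..n}) (p q : {mpoly K[n]}).

Lemma msupp_binomial a b m : a != b ->
  (m \in msupp ('X_[a] - 'X_[b] : {mpoly K[n]})) = (m == a) || (m == b).
Proof.
move=> neq; rewrite mcoeff_msupp mcoeffB !mcoeffX.
rewrite (eq_sym a m) (eq_sym b m); have [->|_] := eqVneq m a.
  by rewrite (negPf neq) subr0 oner_eq0.
by rewrite sub0r oppr_eq0; case: (m == b); rewrite ?oner_eq0 ?eqxx.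
Qed.

Lemma ideal_gen_monomial (S : {mpoly K[n]} -> Prop) u :
  ideal_gen S 'X_[u] ->
  exists2 g, S g & exists2 m, m \in msupp g & (m <= u)%MM.
Proof.
case=> s Ss eX; apply: NNPP => no.
suff : ('X_[u] : {mpoly K[n]})@_u = 0.
  by rewrite mcoeffX eqxx; apply/eqP/oner_neq0.
rewrite eX raddf_sum /= big_seq big1 // => ag /Ss Sg; rewrite mcoeffM big1 //.
move=> k /eqP eu; rewrite [X in _ * X]memN_msupp_eq0 ?mulr0 //.
apply/negP=> ks; apply: no; exists ag.2 => //; exists (k.2 : 'X_{1..n}) => //.
by rewrite [X in (_ <= X)%MM]eu lem_addl.
Qed.

Lemma leading_binomial (le : rel 'X_{1..n}) a b :
  a != b -> le a a -> le b a ->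
  leading_monomial le ('X_[a] - 'X_[b] : {mpoly K[n]}) a.
Proof.
move=> neq laa lba; split=> [|m]; rewrite msupp_binomial ?eqxx //.
by case/orP=> /eqP->.
Qed.

End MonomialIdeals.

Section ToricFibers.
Variables (E : finType) (M : matroid E).
Local Notation n := (nbases M).
Implicit Types (u v a b m : 'X_{1..n}).

Definition incidence (e : E) (j : 'I_n) : nat := e \in basis j.

Definition toric_mnm u : 'X_{1..#|E|} :=
  [multinom wt (incidence (enum_val k)) u | k < #|E|].

Lemma toric_mnmP u v :
  toric_mnm u = toric_mnm v <->
  forall e, wt (incidence e) u = wt (incidence e) v.
Proof.
split=> [/mnmP eq e | eq].
  by have := eq (enum_rank e); rewrite !mnmE enum_rankK.
by apply/mnmP=> k; rewrite !mnmE.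
Qed.

Lemma toric_mnmD u v : toric_mnm (u + v)%MM = (toric_mnm u + toric_mnm v)%MM.
Proof. by apply/mnmP=> k; rewrite mnmDE !mnmE wtD. Qed.

Lemma card_bases (B1 B2 : {set E}) :
  B1 \in bases M -> B2 \in bases M -> #|B1| = #|B2|.
Proof.
have /basis_exchangeP ex := bases_exchange M.
have [k] := ubnP #|B1 :\: B2|; elim: k B1 => // k IH B1 ltk B1M B2M.
have [/setP B10 | [e]] := set_0Vmem (B1 :\: B2); last first.
  rewrite inE => /andP[eB2 eB1].
  have [f [fB2 fB1 fM]] := ex _ _ _ B1M B2M eB1 eB2.
  rewrite -(IH _ _ fM B2M) ?cardsU1 ?[#|B1|](cardsD1 e) ?eB1 //.
    by rewrite !inE negb_and fB1 orbT.
  rewrite (cardsD1 e) !inE eB1 eB2 in ltk.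
  apply: leq_ltn_trans (ltk : _ < k); apply: subset_leq_card.
  apply/subsetP=> x; rewrite !inE; case/andP=> xB2 /orP[/eqP xf|/andP[-> ->]].
    by rewrite xf fB2 in xB2.
  by rewrite xB2.
suff -> : B1 = B2 by [].
apply/eqP; rewrite eqEsubset; apply/andP; split; apply/subsetP=> x.
  by move=> xB1; move: (B10 x); rewrite !inE xB1 andbT => /negbFE.
move=> xB2; apply: contraT => xB1.
have [f [fB1 fB2 _]] := ex _ _ _ B2M B1M xB2 xB1.
by move: (B10 f); rewrite !inE fB1 fB2.
Qed.

Lemma mem_basis (j : 'I_n) : basis j \in bases M.
Proof. exact: enum_valP. Qed.

Lemma sum_wt_incidence :
  exists r, (r = 0 -> set0 \in bases M) /\
    forall u, \sum_e wt (incidence e) u = mdeg u * r.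
Proof.
have /set0Pn[B BM] := bases_neq0 M; exists #|B|.
split=> [/cards0_eq <- //|u]; rewrite -wt_const exchange_big /=.
apply: eq_bigr => j _; rewrite -big_distrr /=; congr muln.
rewrite (card_bases BM (mem_basis j)) -sum1_card [RHS]big_mkcond.
by apply: eq_bigr => e _; rewrite /incidence; case: (e \in _).
Qed.

Lemma fiber_toric u v : fiber (@incidence) u v -> toric_mnm u = toric_mnm v.
Proof. by case=> _ wE; apply/toric_mnmP. Qed.

Lemma toric_fiber u v : set0 \notin bases M ->
  toric_mnm u = toric_mnm v -> fiber (@incidence) u v.
Proof.
move=> nl /toric_mnmP wE; split=> //.
have [r [r0 sumE]] := sum_wt_incidence.
have rgt0 : 0 < r by rewrite lt0n; apply: contra nl => /eqP.
by apply/eqP; rewrite -(eqn_pmul2r rgt0) -!sumE; apply/eqP/eq_bigr=> e _.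
Qed.

Lemma rank0_index (j j' : 'I_n) : set0 \in bases M -> j = j'.
Proof.
move=> M0; have b0 (k : 'I_n) : basis k = set0.
  by apply: cards0_eq; rewrite (card_bases (mem_basis k) M0) cards0.
by apply: enum_val_inj; rewrite -![enum_val _]/(basis _) !b0.
Qed.

Lemma rank0_mnm u v : set0 \in bases M -> mdeg u = mdeg v -> u = v.
Proof.
move=> M0 dE; apply/mnmP=> j.
have deg w : mdeg w = w j.
  rewrite mdegE (bigD1 j) //= big1 ?addn0 // => k.
  by rewrite (rank0_index k j M0) eqxx.
by rewrite -!deg.
Qed.

Lemma rank0_toric u : set0 \in bases M -> toric_mnm u = 0%MM.
Proof.
move=> M0; apply/mnmP=> k; rewrite mnmE mnm0E /wt big1 // => j _.
rewrite /incidence (cards0_eq (A := basis j)) ?inE ?muln0 //.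
by rewrite (card_bases (mem_basis j) M0) cards0.
Qed.

Section Ideal.
Local Open Scope ring_scope.
Variable K : fieldType.
Implicit Types (p q g : {mpoly K[n]}).

Lemma toric_mapX u : toric_map 'X_[u] = 'X_[toric_mnm u] :> {mpoly K[#|E|]}.
Proof.
have mapU (j : 'I_n) :
    toric_map 'X_[U_(j)] = 'X_[toric_mnm U_(j)] :> {mpoly K[#|E|]}.
  rewrite /toric_map comp_mpolyXU -tnth_nth tnth_mktuple.
  rewrite -(big_morph _ (@mpolyXD _ _) (@mpolyX0 _ _)).
  congr 'X_[_]; apply/mnmP=> k; rewrite mnm_sumE mnmE wtU /incidence.
  rewrite big_mkcond (bigD1 (enum_val k)) //= mnm1E enum_valK eqxx.
  rewrite big1 ?addn0; first by case: (_ \in _).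
  move=> e ne; case: (_ \in _) => //; rewrite mnm1E.
  by apply/eqP; rewrite eqb0; apply: contra ne => /eqP <-; rewrite enum_rankK.
elim/mnm_ind: u => [|j u IH].
  have -> : toric_mnm 0%MM = 0%MM by apply/mnmP=> k; rewrite mnmE wt0 mnm0E.
  by rewrite !mpolyX0 /toric_map comp_mpoly1.
rewrite toric_mnmD !mpolyXD /toric_map rmorphM /=.
by rewrite -![_ \mPo _]/(toric_map _) mapU IH.
Qed.

Lemma mem_toric_binomial u v :
  ('X_[u] - 'X_[v] \in @toric_ideal K E M) = (toric_mnm u == toric_mnm v).
Proof.
rewrite inE /toric_map raddfB /=.
rewrite -![_ \mPo _]/(toric_map _) !toric_mapX subr_eq0.
apply/eqP/eqP=> [|-> //] /(congr1 (mcoeff (toric_mnm u))).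
rewrite !mcoeffX eqxx; case: eqP => // _ /eqP.
by rewrite oner_eq0.
Qed.

Lemma toric_ideal_mate p u : p \in @toric_ideal K E M -> u \in msupp p ->
  exists v, [/\ v \in msupp p, v != u & toric_mnm v = toric_mnm u].
Proof.
rewrite inE /toric_map comp_mpolyEX => /eqP p0 us; apply: NNPP => no.
have : (\sum_(m <- msupp p) p@_m *: toric_map 'X_[m])@_(toric_mnm u) = p@_u.
  rewrite (raddf_sum (mcoeff (toric_mnm u))) /= (bigD1_seq u) ?msupp_uniq //=.
  rewrite mcoeffZ toric_mapX mcoeffX eqxx mulr1.
  rewrite big_seq_cond big1 ?addr0 // => v.
  case/andP=> vs vu; rewrite mcoeffZ toric_mapX mcoeffX.
  by case: eqP => [e|_]; [case: no; exists v | rewrite mulr0].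
by rewrite p0 mcoeff0 => /esym/eqP; apply/negP; rewrite -mcoeff_msupp.
Qed.

Lemma toric_ideal_gen (S : {mpoly K[n]} -> Prop) p :
  (forall u v, toric_mnm u = toric_mnm v -> ideal_gen S ('X_[u] - 'X_[v])) ->
  p \in @toric_ideal K E M -> ideal_gen S p.
Proof.
move=> SX; have [k] := ubnP (size (msupp p)); elim: k p => // k IH p ltk pJ.
case Es: (msupp p) => [|u s].
  by rewrite (msuppnil0 Es); apply: ideal_gen0.
have us : u \in msupp p by rewrite Es mem_head.
have [v [vs vu tE]] := toric_ideal_mate pJ us.
pose q := p - p@_u *: ('X_[u] - 'X_[v]).
have qE : q = p - p@_u *: ('X_[u] - 'X_[v]) by [].
rewrite -(subrK (p@_u *: ('X_[u] - 'X_[v])) p) -qE.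
apply: ideal_genD; last first.
  by rewrite -mul_mpolyC; apply/ideal_genM/SX.
have qm m : q@_m = p@_m - p@_u * ((u == m)%:R - (v == m)%:R).
  by rewrite qE mcoeffB mcoeffZ mcoeffB !mcoeffX.
apply: IH.
  rewrite -ltnS; apply: leq_trans ltk.
  rewrite ltnS (perm_size (perm_to_rem us)) /= ltnS.
  apply: uniq_leq_size; first exact: msupp_uniq.
  move=> m; rewrite mcoeff_msupp qm (mem_rem_uniq _ (msupp_uniq p)) inE.
  have [->|mu] := eqVneq m u.
    by rewrite (negPf vu) subr0 mulr1 subrr eqxx.
  rewrite /= mcoeff_msupp; apply: contra => /eqP pm.
  have [e|_] := eqVneq v m; first by move: vs; rewrite mcoeff_msupp e pm eqxx.
  by rewrite pm subrr mulr0 subrr.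
move: pJ; have : 'X_[u] - 'X_[v] \in @toric_ideal K E M.
  by rewrite mem_toric_binomial tE.
rewrite !inE qE /toric_map => /eqP b0 /eqP p0.
by rewrite raddfB /= comp_mpolyZ p0 b0 scaler0 subrr.
Qed.

End Ideal.

End ToricFibers.

(** * Quadratic generation and Groebner bases in terms of fibers *)

Section QuadraticBinomials.
Local Open Scope ring_scope.
Variables (K : fieldType) (E : finType) (M : matroid E).
Local Notation n := (nbases M).
Local Notation J := (@toric_ideal K E M).
Local Notation inc := (@incidence E M).
Implicit Types (u v a b m : 'X_{1..n}) (p q g : {mpoly K[n]}).

Lemma msize_binomial a b : a != b ->
  msize ('X_[a] - 'X_[b] : {mpoly K[n]}) = (maxn (mdeg a) (mdeg b)).+1.
Proof.
move=> neq; apply/eqP; rewrite eqn_leq; apply/andP; split.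
  apply: leq_trans (mmeasureD_le _ _ _) _.
  by rewrite mmeasureN !mmeasureX /=; lia.
suff: (mdeg a < msize ('X_[a] - 'X_[b] : {mpoly K[n]}))%N /\
      (mdeg b < msize ('X_[a] - 'X_[b] : {mpoly K[n]}))%N by lia.
by split; apply: msize_mdeg_lt; rewrite msupp_binomial // eqxx ?orbT.
Qed.

Lemma toric_quadratic g : set0 \notin bases M -> g \in J ->
  is_binomial g -> is_quadratic g ->
  exists a b, [/\ g = 'X_[a] - 'X_[b], a != b, mdeg a = 2%N & fiber inc a b].
Proof.
move=> nl gJ [a [b [neq gE]]]; rewrite gE in gJ *.
have fab : fiber inc a b.
  by apply: toric_fiber => //; move: gJ; rewrite mem_toric_binomial => /eqP.
rewrite /is_quadratic msize_binomial // -(proj1 fab) maxnn => -[da].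
by exists a, b.
Qed.

Definition fiberb u v : bool :=
  (mdeg u == mdeg v) && [forall e, wt (inc e) u == wt (inc e) v].

Lemma fiberP u v : reflect (fiber inc u v) (fiberb u v).
Proof.
apply: (iffP andP) => -[/eqP dE wE]; split=> //.
  by move=> e; apply/eqP; move/forallP: wE.
by apply/forallP=> e; rewrite wE.
Qed.

Definition toric_quadrics : seq {mpoly K[n]} :=
  [seq 'X_[val x.1] - 'X_[val x.2] | x in
    [pred x : 'X_{1..n < 3} * 'X_{1..n < 3} |
      [&& val x.1 != val x.2, mdeg (val x.1) == 2%N
        & fiberb (val x.1) (val x.2)]]].

Lemma toric_quadricsP g : reflect
  (exists a b, [/\ g = 'X_[a] - 'X_[b], a != b, mdeg a = 2%N & fiber inc a b])
  (g \in toric_quadrics).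
Proof.
apply: (iffP imageP) => [[[a b] /= /and3P[neq /eqP da /fiberP fab] ->] | ].
  by exists (val a), (val b).
case=> a [b [-> neq da fab]].
have lta : (mdeg a < 3)%N by rewrite da.
have ltb : (mdeg b < 3)%N by rewrite -(proj1 fab) da.
exists (BMultinom lta, BMultinom ltb) => //.
by rewrite inE; apply/and3P; split=> //; [rewrite /= da | apply/fiberP].
Qed.

Lemma toric_quadrics_sub : {subset toric_quadrics <= J}.
Proof.
move=> g /toric_quadricsP[a [b [-> _ _ /fiber_toric tE]]].
by rewrite mem_toric_binomial tE.
Qed.

Lemma toric_quadrics_quadratic : quadratic_binomials toric_quadrics.
Proof.
move=> g /toric_quadricsP[a [b [-> neq da fab]]]; split; first by exists a, b.
by rewrite /is_quadratic msize_binomial // -(proj1 fab) da.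
Qed.

Lemma qconn_ideal (S : {mpoly K[n]} -> Prop) u v :
  (forall a b, mdeg a = 2%N -> fiber inc a b ->
     ideal_gen S ('X_[a] - 'X_[b])) ->
  qconn inc u v -> ideal_gen S ('X_[u] - 'X_[v]).
Proof.
move=> SX; elim=> [w|m a b w da fab _ IH].
  by rewrite subrr; apply: ideal_gen0.
rewrite -(subrKA 'X_[m + b]); apply: ideal_genD => //.
by rewrite !mpolyXD -mulrBr; apply/ideal_genM/SX.
Qed.

Lemma class_Q_of_connected : set0 \notin bases M ->
  quadratically_connected inc -> class_Q K M.
Proof.
move=> nl conn; exists toric_quadrics; last exact: toric_quadrics_quadratic.
move=> p; split; last first.
  case=> s Ss ->; rewrite inE /toric_map raddf_sum /= big_seq big1 // => ag /Ss.
  move/toric_quadrics_sub; rewrite inE /toric_map rmorphM /= => /eqP->.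
  by rewrite mulr0.
apply: toric_ideal_gen => u v tE; apply: qconn_ideal; last first.
  by apply: conn; apply: toric_fiber.
move=> a b da fab; have [->|neq] := eqVneq a b.
  by rewrite subrr; apply: ideal_gen0.
by apply: ideal_gen_mem; apply/toric_quadricsP; exists a, b.
Qed.

Lemma rank0_class_Q : set0 \in bases M -> class_Q K M.
Proof.
move=> M0; pose X j : {mpoly K[n]} := 'X_[U_(j)].
pose sq j : {mpoly K[n]} := 'X_[U_(j) + U_(j)].
pose G := [seq sq j - X j | j : 'I_n] ++ [seq sq j - 'X_[0] | j : 'I_n].
have binG g : g \in G -> exists a b,
    [/\ g = 'X_[a] - 'X_[b], mdeg a = 2%N & (mdeg b < 2)%N].
  rewrite mem_cat => /orP[/imageP[j _ ->]|/imageP[j _ ->]].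
    by exists (U_(j) + U_(j))%MM, U_(j)%MM; rewrite mdegD !mdeg1.
  by exists (U_(j) + U_(j))%MM, 0%MM; rewrite mdegD !mdeg1 mdeg0.
exists G => [p|g /binG[a [b [-> da db]]]]; last first.
  have neq : a != b by apply: contraTneq db => <-; rewrite da.
  by split; [exists a, b | rewrite /is_quadratic msize_binomial // da; lia].
split; last first.
  case=> s Ss ->; rewrite inE /toric_map raddf_sum /= big_seq big1 // => ag /Ss.
  case/binG=> a [b [gE _ _]].
  have : ag.2 \in J by rewrite gE mem_toric_binomial !rank0_toric.
  by rewrite inE /toric_map rmorphM /= => /eqP->; rewrite mulr0.
have X1 u : ideal_gen (fun g => g \in G) ('X_[u] - 1).
  elim/mnm_ind: u => [|j u IH].
    by rewrite mpolyX0 subrr; apply: ideal_gen0.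
  have -> : 'X_[U_(j) + u] - 1 =
      X j * ('X_[u] - 1) + ((sq j - 'X_[0]) + (-1) * (sq j - X j))
      :> {mpoly K[n]}.
    by rewrite mpolyXD mpolyX0 /X; ring.
  apply: ideal_genD; first exact: ideal_genM.
  apply: ideal_genD; last apply: ideal_genM;
    apply: ideal_gen_mem; rewrite mem_cat.
    by apply/orP; right; apply/imageP; exists j.
  by apply/orP; left; apply/imageP; exists j.
apply: toric_ideal_gen => u v _.
have -> : 'X_[u] - 'X_[v] =
    ('X_[u] - 1) + (-1) * ('X_[v] - 1) :> {mpoly K[n]} by ring.
by apply: ideal_genD => //; apply: ideal_genM.
Qed.

Lemma connected_of_class_Q : class_Q K M -> quadratically_connected inc.
Proof.
have [M0 _ u v [dE _]|nl [G genG quadG] u v fuv] := boolP (set0 \in bases M).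
  by rewrite (rank0_mnm M0 dE); apply: qconn_refl.
pose C w : bool := excluded_middle_informative (qconn inc u w).
have CP w : reflect (qconn inc u w) (C w).
  by rewrite /C; case: excluded_middle_informative => h; constructor.
have Cstep m a b : mdeg a = 2%N -> fiber inc a b -> C (m + a)%MM = C (m + b)%MM.
  move=> da fab; apply/CP/CP => h; apply: qconn_trans h _.
    by apply: qconn_step fab _ => //; apply: qconn_refl.
  apply: qconn_step (fiber_sym fab) _; last exact: qconn_refl.
  by rewrite -(proj1 fab).
(* L vanishes on the ideal, being the truncated indicator of the class of u. *)
pose L p : K := \sum_(w : 'X_{1..n < (mdeg u).+1} | C (val w)) p@_(val w).
have LD p q : L (p + q) = L p + L q.
  by rewrite /L -big_split; apply: eq_bigr => w _; rewrite mcoeffD.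
have LB p q : L (p - q) = L p - L q.
  by rewrite /L -sumrB; apply: eq_bigr => w _; rewrite mcoeffB.
have L0 : L 0 = 0 by rewrite /L big1 // => w _; rewrite mcoeff0.
have LZ c p : L (c *: p) = c * L p.
  by rewrite /L mulr_sumr; apply: eq_bigr => w _; rewrite mcoeffZ.
have LX m : L 'X_[m] = ((mdeg m < (mdeg u).+1)%N && C m)%:R.
  have [lt|ge] /= := boolP (mdeg m < (mdeg u).+1)%N; last first.
    rewrite /L big1 // => w _; rewrite mcoeffX; case: eqP => // e.
    by case/negP: ge; rewrite e; apply: bmdeg.
  rewrite /L big_mkcond (bigD1 (BMultinom lt)) //= mcoeffX eqxx big1 ?addr0.
    by case: (C m).
  move=> w neq; case: (C _) => //; rewrite mcoeffX; case: eqP => // e.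
  by case/negP: neq; apply/eqP/val_inj.
have LG g p : g \in G -> L (p * g) = 0.
  move=> gG; have [bg qg] := quadG g gG.
  have gJ : g \in J by apply/genG; apply: ideal_gen_mem.
  have [a [b [-> _ da fab]]] := toric_quadratic nl gJ bg qg.
  rewrite [p]mpolyE mulr_suml; elim/big_rec: _ => // m q _ IH.
  rewrite LD IH addr0 -scalerAl LZ mulrBr -!mpolyXD LB !LX (Cstep m a b) //.
  by rewrite !mdegD (proj1 fab) subrr mulr0.
have /genG[s sG sE] : 'X_[u] - 'X_[v] \in J.
  by rewrite mem_toric_binomial (fiber_toric fuv).
have : L ('X_[u] - 'X_[v]) = 0.
  rewrite sE big_seq; elim/big_rec: _ => // ag q /sG agG IH.
  by rewrite LD IH LG // addr0.
rewrite LB !LX -(proj1 fuv) ltnSn /=.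
have -> : C u by apply/CP/qconn_refl.
by case: (CP v) => // _ /eqP; rewrite subr0 oner_eq0.
Qed.

Lemma class_QG_of_minimized : set0 \notin bases M ->
  quadratically_minimized inc -> class_QG K M.
Proof.
move=> nl [le ord minM]; exists le, toric_quadrics; split=> //; last first.
  exact: toric_quadrics_quadratic.
have [le_anti le_trans le_total le_min le_add] := ord.
have lexx x : le x x by case/orP: (le_total x x).
split; first exact: toric_quadrics_sub.
move=> q; split; apply: ideal_gen_sub => {}q;
  case=> [p [m [pG [mp lem] ->]]]; last first.
  by apply: ideal_gen_mem; exists p, m; split=> //; apply: toric_quadrics_sub.
have [v [vp vm tE]] := toric_ideal_mate pG mp.
have fmv : fiber inc m v by apply: toric_fiber.
have [a [b [ale da fab nle]]] : exists a b,
    [/\ (a <= m)%MM, mdeg a = 2%N, fiber inc a b & ~ le a b].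
  apply: NNPP => no; case/eqP: vm; apply: le_anti; rewrite lem //=.
  apply: minM fmv => a b ale da fab; apply: NNPP => nle; apply: no.
  by exists a, b.
have lba : le b a by case/orP: (le_total a b).
have neq : a != b by apply/eqP=> e; apply: nle; rewrite e.
rewrite -(submK ale) mpolyXD; apply: ideal_genM; apply: ideal_gen_mem.
exists ('X_[a] - 'X_[b]), a; split=> //; last exact: leading_binomial.
by apply/toric_quadricsP; exists a, b.
Qed.

Lemma class_QG_rank_gt0 : class_QG K M -> set0 \notin bases M.
Proof.
case=> le [G [[le_anti le_trans le_total le_min le_add] [GJ gbG] quadG]].
apply/negP=> M0; have /set0Pn[B BM] := bases_neq0 M.
pose j : 'I_n := enum_rank_in BM B.
have neq : U_(j)%MM != 0%MM :> 'X_{1..n} by rewrite mnm1_eq0.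
have lexx x : le x x by case/orP: (le_total x x).
have : ideal_gen (initial_monomials le (mem G)) 'X_[U_(j)].
  apply/gbG; apply: ideal_gen_mem.
  exists ('X_[U_(j)] - 'X_[0]), U_(j)%MM; split=> //.
    by rewrite mem_toric_binomial !rank0_toric.
  exact: leading_binomial.
case/ideal_gen_monomial=> _ [g [m [gG [mg lem] ->]]] [m'].
rewrite msuppX inE => /eqP-> mle.
have [[a [b [nab gE]]] qg] := quadG g gG.
have [c cg dc] : exists2 c, c \in msupp g & mdeg c = 2%N.
  move: qg; rewrite /is_quadratic gE msize_binomial //.
  case: (leqP (mdeg a) (mdeg b)) => _ [dc]; [exists b | exists a] => //;
    by rewrite msupp_binomial // eqxx ?orbT.
have eU w : mdeg w = 1%N -> w = U_(j)%MM.
  by move=> dw; apply: rank0_mnm => //; rewrite mdeg1.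
have cE : c = (U_(j) + U_(j))%MM by apply: rank0_mnm => //; rewrite mdegD mdeg1.
have lecU : le c U_(j)%MM.
  apply: (le_trans m); first exact: lem.
  by rewrite -(submK mle) -[X in le X](add0m m); apply: le_add; apply: le_min.
have leUc : le U_(j)%MM c.
  by rewrite cE -[X in le X](add0m U_(j)%MM); apply: le_add; apply: le_min.
have : c = U_(j)%MM by apply: le_anti; rewrite lecU.
by move/(congr1 (@mdeg _)); rewrite dc mdeg1.
Qed.

Lemma minimized_of_class_QG : class_QG K M -> quadratically_minimized inc.
Proof.
move=> QG; have nl := class_QG_rank_gt0 QG.
case: QG => le [G [ord [GJ gbG] quadG]].
exists le => //; have [le_anti le_trans le_total le_min le_add] := ord.
have lexx x : le x x by case/orP: (le_total x x).
move=> u v umin fuv; apply: contraT => /negP nle.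
have lvu : le v u by case/orP: (le_total u v).
have nuv : u != v by apply/eqP=> e; apply: nle; rewrite e.
have : ideal_gen (initial_monomials le (mem G)) 'X_[u].
  apply/gbG; apply: ideal_gen_mem; exists ('X_[u] - 'X_[v]), u; split=> //.
    by rewrite mem_toric_binomial (fiber_toric fuv).
  exact: leading_binomial.
case/ideal_gen_monomial=> _ [g [m [gG [mg lem] ->]]] [m'].
rewrite msuppX inE => /eqP-> mle.
have [bg qg] := quadG g gG.
have [a [b [gE nab da fab]]] := toric_quadratic nl (GJ g gG) bg qg.
have lead x : x \in [:: a; b] -> le x m.
  by rewrite !inE => xab; apply: lem; rewrite gE msupp_binomial.
have la : le a m by apply: lead; rewrite mem_head.
have lb : le b m by apply: lead; rewrite inE mem_head orbT.
move: mg; rewrite gE msupp_binomial // => /orP[]/eqP em.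
  have lab : le a b by apply: umin => //; rewrite -em.
  by case/eqP: nab; apply: le_anti; rewrite lab -em.
have lba : le b a.
  by apply: umin; [rewrite -em | rewrite -(proj1 fab) | apply: fiber_sym].
by case/eqP: nab; apply: le_anti; rewrite lba -em la.
Qed.

End QuadraticBinomials.

(** * Dual, series and parallel extensions *)

Section BasisIndex.
Variables (E : finType) (M : matroid E).

Definition basis_index B (BM : B \in bases M) : 'I_(nbases M) :=
  enum_rank_in BM B.

Lemma basis_indexK B (BM : B \in bases M) : basis (basis_index BM) = B.
Proof. exact: enum_rankK_in. Qed.

Lemma basis_inj : injective (@basis E M).
Proof. exact: enum_val_inj. Qed.

End BasisIndex.

Section Dual.
Variables (E : finType) (M : matroid E).

Lemma dual_basisP (j : 'I_(nbases (dual M))) : ~: basis j \in bases M.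
Proof. by rewrite -mem_dual_bases; apply: (mem_basis j). Qed.

Lemma quadratic_dual :
  (quadratically_connected (@incidence E M) ->
     quadratically_connected (@incidence E (dual M))) /\
  (quadratically_minimized (@incidence E M) ->
     quadratically_minimized (@incidence E (dual M))).
Proof.
pose pi j := basis_index (dual_basisP j).
have piE j : basis (pi j) = ~: basis j by apply: basis_indexK.
apply: (@quadratic_ext _ _ _ _ _ _ pi predT pred0).
- move=> i [] // _.
  have iD : ~: basis i \in bases (dual M).
    by rewrite mem_dual_bases setCK mem_basis.
  exists (basis_index iD) => //; apply: basis_inj.
  by rewrite piE basis_indexK setCK.
- by [].
- by move=> j j' /(congr1 (@basis _ _)); rewrite !piE => /setC_inj/basis_inj.
- move=> u v; rewrite /= !wt_const !muln1.
  have wtE e w :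
      wt (incidence e) (push pi w) + wt (@incidence _ (dual M) e) w = mdeg w.
    rewrite wt_push -(wt_compl (fun j => e \in basis j)); congr addn.
    by apply: eq_wt => j /=; rewrite /incidence piE inE.
  split=> [[dE wE]|[[dE wE] _]].
    split=> //; split=> [|e]; first by rewrite !mdeg_push.
    by have := wE e; have := wtE e u; have := wtE e v; lia.
  rewrite !mdeg_push in dE; split=> // e.
  by have := wE e; have := wtE e u; have := wtE e v; lia.
by move=> x y _; rewrite !wt_const !muln0.
Qed.

End Dual.

Section SeriesExtension.
Variables (d : nat) (M : matroid 'I_d) (c : 'I_d).
Local Notation N := (series_ext M c).

(* [old c \in X] comes from B only if d+1 is in X. *)
Definition series_restr (X : {set 'I_d.+1}) : {set 'I_d} :=
  [set i | (old i \in X) && ((i != c) || (ord_max \in X))].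

Let inOld := (inE, mem_old, max_mem_old, old_neq_max, max_neq_old,
              inj_eq (@old_inj d), eqxx, orbF, orbT, andbT, andbF).

Lemma series_restr_max (B : {set 'I_d}) :
  series_restr ((@old d @: B) :|: [set ord_max]) = B.
Proof. by apply/setP=> i; rewrite !inOld. Qed.

Lemma series_restr_old (B : {set 'I_d}) : c \notin B ->
  series_restr ((@old d @: B) :|: [set old c]) = B.
Proof.
move=> cB; apply/setP=> i; rewrite !inOld.
by have [->|_] := eqVneq i c; rewrite ?(negPf cB) !inOld.
Qed.

Lemma series_restrP X : X \in bases N ->
  series_restr X \in bases M /\
  forall i, (old i \in X) =
    (i \in series_restr X) || (i == c) && (ord_max \notin X).
Proof.
case/series_basesP=> B BM [->|[cB ->]].
  by rewrite series_restr_max; split=> // i; rewrite !inOld.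
by rewrite series_restr_old //; split=> // i; rewrite !inOld.
Qed.

Lemma series_basisP (j : 'I_(nbases N)) : series_restr (basis j) \in bases M.
Proof. by case: (series_restrP (mem_basis j)). Qed.

Lemma quadratic_series :
  (quadratically_connected (@incidence _ M) ->
     quadratically_connected (@incidence _ N)) /\
  (quadratically_minimized (@incidence _ M) ->
     quadratically_minimized (@incidence _ N)).
Proof.
pose pi j := basis_index (series_basisP j).
have piE j : basis (pi j) = series_restr (basis j) by apply: basis_indexK.
pose t (j : 'I_(nbases N)) := ord_max \in basis j.
pose free (i : 'I_(nbases M)) := c \notin basis i.
have oldE j i :
    (old i \in basis j) = (i \in basis (pi j)) || (i == c) && ~~ t j.
  by rewrite piE; case: (series_restrP (mem_basis j)).
apply: (@quadratic_ext _ _ _ _ _ _ pi t free).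
- move=> i b bi.
  pose X := (@old d @: basis i) :|: [set if b then ord_max else old c].
  have XN : X \in bases N.
    rewrite /X; case: b bi {X} => /= bi; first exact/series_max/mem_basis.
    exact: series_old (mem_basis i) bi.
  exists (basis_index XN); last first.
    by rewrite /t basis_indexK /X; case: b {bi X XN}; rewrite !inOld.
  apply: basis_inj; rewrite piE basis_indexK /X.
  case: b bi {X XN} => /= bi; first exact: series_restr_max.
  exact: series_restr_old.
- move=> j; rewrite /free piE inE eqxx /= -/(t j).
  by case: (t j); rewrite ?andbF.
- move=> j j' /(congr1 (@basis _ _)) pE tE; apply: basis_inj; apply/setP=> x.
  by case: (oldP x) => [->|[i ->]]; [exact: tE | rewrite !oldE pE tE].
- have wt_old i u : i != c ->
      wt (@incidence _ N (old i)) u = wt (incidence i) (push pi u).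
    move=> ic; rewrite wt_push; apply: eq_wt => j /=.
    by rewrite /incidence oldE (negPf ic) orbF.
  have wt_c u : wt (@incidence _ N (old c)) u + wt (fun j => t j : nat) u =
      wt (incidence c) (push pi u) + mdeg u.
    rewrite wt_push -[mdeg u]muln1 -wt_const -!wt_add; apply: eq_wt => j /=.
    rewrite /incidence oldE eqxx /=; case tj: (t j); rewrite ?orbF ?orbT //=.
    by rewrite piE inE eqxx /= -/(t j) tj andbF.
  move=> u v; split=> [[dE wE]|[[dE wE] tE]].
    have tE : wt (fun j => t j : nat) u = wt (fun j => t j : nat) v.
      exact: wE ord_max.
    split=> //; split=> [|i]; first by rewrite !mdeg_push.
    have [->|ic] := eqVneq i c; last by rewrite -!wt_old.
    by apply: (@addIn (mdeg u)); rewrite -wt_c [in RHS]dE -wt_c wE tE.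
  rewrite !mdeg_push in dE; split=> // x.
  case: (oldP x) => [->|[i ->]]; first exact: tE.
  have [->|ic] := eqVneq i c; last by rewrite !wt_old.
  apply: (@addIn (wt (fun j => t j : nat) u)).
  by rewrite wt_c [in RHS]tE wt_c wE dE.
move=> x y [dE wE]; apply: (@addIn (wt (incidence c) x)); rewrite [in RHS]wE.
pose inB (i : 'I_(nbases M)) := c \in basis i.
exact: etrans (wt_compl inB x) (etrans dE (esym (wt_compl inB y))).
Qed.

Lemma set0_series_ext : set0 \notin bases N.
Proof.
apply/negP=> /series_basesP[B _ [|[_]] /setP].
  by move/(_ ord_max); rewrite !inOld.
by move/(_ (old c)); rewrite !inOld.
Qed.

Lemma set0_parallel_ext : set0 \in bases (parallel_ext M c) -> set0 \in bases M.
Proof.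
rewrite mem_dual_bases setC0 => /series_basesP[B]; rewrite mem_dual_bases => BM.
case=> [/setP TE|[_ /setP/(_ ord_max)]]; last by rewrite !inOld.
suff -> : set0 = ~: B by [].
by apply/setP=> i; move: (TE (old i)); rewrite !inOld => <-.
Qed.

End SeriesExtension.

Lemma quadratic_parallel (d : nat) (M : matroid 'I_d) (c : 'I_d) :
  (quadratically_connected (@incidence _ M) ->
     quadratically_connected (@incidence _ (parallel_ext M c))) /\
  (quadratically_minimized (@incidence _ M) ->
     quadratically_minimized (@incidence _ (parallel_ext M c))).
Proof.
have [dQ dG] := quadratic_dual M; have [sQ sG] := quadratic_series (dual M) c.
have [pQ pG] := quadratic_dual (series_ext (dual M) c).
by split=> [/dQ/sQ/pQ | /dG/sG/pG].
Qed.

Theorem theorem2p6 (K : fieldType) :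
  (forall (d : nat) (M : matroid 'I_d) (c : 'I_d), class_QG K M ->
     class_QG K (series_ext M c) /\ class_QG K (parallel_ext M c)) /\
  (forall (d : nat) (M : matroid 'I_d) (c : 'I_d), class_Q K M ->
     class_Q K (series_ext M c) /\ class_Q K (parallel_ext M c)).
Proof.
split=> d M c.
  move=> QG; have nl := class_QG_rank_gt0 QG.
  have G := minimized_of_class_QG QG.
  split; apply: class_QG_of_minimized.
  - exact: set0_series_ext.
  - exact: (proj2 (quadratic_series M c)).
  - exact: contra (@set0_parallel_ext d M c) nl.
  exact: (proj2 (quadratic_parallel M c)).
move=> /connected_of_class_Q Q; split.
  apply: class_Q_of_connected; first exact: set0_series_ext.
  exact: (proj1 (quadratic_series M c)).
have [P0|nP0] := boolP (set0 \in bases (parallel_ext M c)).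
  exact: rank0_class_Q.
by apply: class_Q_of_connected => //; apply: (proj1 (quadratic_parallel M c)).
Qed.
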